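(* Let $\mathbf{C}$ be a locally small directed category with finite Ramsey degrees. Then $\mathbf{C}$ has the weak amalgamation property.
   Context: $\mathrm{Ob}(\mathbf{C})$ is the class of objects of $\mathbf{C}$, composition is written with a dot, and $A \to B$ means $\hom(A,B) \neq \varnothing$. A category is directed if for all objects $A, B$ there is an object $C$ with $A \to C$ and $B \to C$. For positive integers $k,t$ and objects $A,B,C$ with $A \to B$, write $C \longrightarrow (B)^A_{k,t}$ if for every coloring $\chi : \hom(A,C) \to \{0,\dots,k-1\}$ there is a $w \in \hom(B,C)$ such that $|\{\chi(w\cdot f) : f \in \hom(A,B)\}| \le t$. The Ramsey degree $t_{\mathbf{C}}(A)$ of $A$ in $\mathbf{C}$ is the least positive integer $n$ such that for all $k$ and all objects $B$ with $A\to B$ there is an object $C$ with $C \longrightarrow (B)^A_{k,n}$, if such $n$ exists, and $\infty$ otherwise. $\mathbf{C}$ has finite Ramsey degrees if $t_{\mathbf{C}}(A) < \infty$ for all $A \in \mathrm{Ob}(\mathbf{C})$. $\mathbf{C}$ has the weak amalgamation property if for every $A \in \mathrm{Ob}(\mathbf{C})$ there are $A' \in \mathrm{Ob}(\mathbf{C})$ and a morphism $f \in \hom(A,A')$ such that for all $B, C \in \mathrm{Ob}(\mathbf{C})$ and all $g \in \hom(A',B)$, $h \in \hom(A',C)$ there are $D \in \mathrm{Ob}(\mathbf{C})$ and morphisms $r \in \hom(B,D)$, $s \in \hom(C,D)$ with $r\cdot g\cdot f = s\cdot h\cdot f$. *)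

(* Defs.v *)
From mathcomp Require Import all_boot.
From mathcomp Require Import boolp.

Set Implicit Arguments.
Unset Strict Implicit.
Unset Printing Implicit Defensive.

(* The universe levels of [Ob] and [hom] are independent of each other: objects
   may form a proper class, while each [hom A B] is a set (local smallness). *)
Record category := Category {
  Ob : Type;
  hom : Ob -> Ob -> Type;
  idm : forall A : Ob, hom A A;
  compm : forall A B C : Ob, hom B C -> hom A B -> hom A C;
  compm1l : forall (A B : Ob) (f : hom A B), compm (idm B) f = f;
  compm1r : forall (A B : Ob) (f : hom A B), compm f (idm A) = f;
  compmA : forall (A B C D : Ob) (h : hom C D) (g : hom B C) (f : hom A B),
    compm h (compm g f) = compm (compm h g) f
}.

Declare Scope cat_scope.
Delimit Scope cat_scope with cat.
Notation "g · f" := (compm g f) (at level 40, left associativity) : cat_scope.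
Local Open Scope cat_scope.

Definition arrow (C : category) (A B : Ob C) : Prop := inhabited (hom A B).

Definition directed (C : category) : Prop :=
  forall A B : Ob C, exists D : Ob C, arrow A D /\ arrow B D.

(* [ramsey_arrow A B D k t] is D --> (B)^A_{k,t}. *)
Definition ramsey_arrow (C : category) (A B D : Ob C) (k t : nat) : Prop :=
  forall chi : hom A D -> 'I_k,
  exists w : hom B D,
    #|[set c : 'I_k | `[< exists f : hom A B, chi (w · f) = c >]]| <= t.

Definition ramsey_bound (C : category) (A : Ob C) (n : nat) : bool :=
  `[< 0 < n /\
      forall (k : nat) (B : Ob C), 0 < k -> arrow A B ->
      exists D : Ob C, ramsey_arrow A B D k n >].

(* Values in the positive integers extended with infinity, encoded as [None]. *)
Definition ramsey_degree (C : category) (A : Ob C) : option nat :=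
  match pselect (exists n, ramsey_bound A n) with
  | left ex_n => Some (ex_minn ex_n)
  | right _ => None
  end.

Definition finite_ramsey_degrees (C : category) : Prop :=
  forall A : Ob C, ramsey_degree A <> None.

Definition weak_amalgamation (C : category) : Prop :=
  forall A : Ob C, exists (A' : Ob C) (f : hom A A'),
  forall (B1 B2 : Ob C) (g : hom A' B1) (h : hom A' B2),
  exists (D : Ob C) (r : hom B1 D) (s : hom B2 D),
    r · g · f = s · h · f.

(* Main.v *)
Require Import Defs.
From mathcomp Require Import all_boot.
From mathcomp Require Import boolp.

Set Implicit Arguments.
Unset Strict Implicit.
Unset Printing Implicit Defensive.

Local Open Scope cat_scope.

(** If weak amalgamation fails at [A], every morphism out of [A] extends in two
    incompatible ways, so by directedness some [hom A B] contains [n + 1] pairwise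
    incompatible morphisms, [n] being a bound on the Ramsey degree of [A].
    Coloring a morphism [A -> D] by the index of the morphism of this family
    that it extends forces [n + 1] colors on every copy of [B] in [D]. *)

Definition compatible (C : category) (A B1 B2 : Ob C)
    (u : hom A B1) (v : hom A B2) : Prop :=
  exists (D : Ob C) (r : hom B1 D) (s : hom B2 D), r · u = s · v.

(** Used contrapositively: an incompatible pair stays incompatible under any further extension. *)
Lemma compatible_comp (C : category) (A B1 B2 B1' B2' : Ob C)
    (u : hom A B1) (v : hom A B2) (g : hom B1 B1') (h : hom B2 B2') :
  compatible (g · u) (h · v) -> compatible u v.
Proof.
by move=> [D [r [s e]]]; exists D, (r · g), (s · h); rewrite -!compmA.
Qed.

Lemma incompatible_family (C : category) (A : Ob C) (N : nat) :
  directed C ->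
  (forall (A' : Ob C) (f : hom A A'), exists (B1 B2 : Ob C)
    (g : hom A' B1) (h : hom A' B2), ~ compatible (g · f) (h · f)) ->
  exists (B : Ob C) (m : nat -> hom A B),
    forall i j, i < j <= N -> ~ compatible (m i) (m j).
Proof.
move=> dirC split; elim: N => [|N [B [m mP]]].
  by exists A, (fun=> idm A) => i j /andP[ij]; rewrite leqn0 => /eqP j0; rewrite j0 in ij.
have [B1 [B2 [g [h gh]]]] := split _ (m 0).
have [D [[r] [s]]] := dirC B1 B2.
(* The two incompatible extensions of [m 0] meet in [D]: the one along [g] replaces [m 0], the one
   along [h] is the new member, of index [N.+1]. *)
exists D, (fun i => if i <= N then r · (g · m i) else s · (h · m 0)).
move=> i j /andP[ij]; rewrite leq_eqVlt ltnS => /orP[/eqP jE|jN].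
  rewrite jE ltnn; have iN : i <= N by rewrite -ltnS -jE.
  rewrite iN; have [->|i_gt0] := posnP i.
    by move=> /compatible_comp /gh.
  (* The new member extends [m 0], which is already incompatible with [m i]. *)
  move=> /compatible_comp /compatible_comp [E [p [q e]]].
  by apply: (mP 0 i); [rewrite i_gt0 | exists E, q, p].
rewrite jN (leq_trans (ltnW ij) jN).
by move=> /compatible_comp /compatible_comp; apply: mP; rewrite ij.
Qed.

Lemma incompatible_not_ramsey_arrow (C : category) (A B D : Ob C) (n : nat)
    (m : nat -> hom A B) :
  (forall i j, i < j <= n -> ~ compatible (m i) (m j)) ->
  ~ ramsey_arrow A B D n.+1 n.
Proof.
move=> mP ram.
have uniq_index (i j : 'I_n.+1) (r s : hom B D) : r · m i = s · m j -> i = j.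
  move=> e; apply: val_inj => /=; case: (ltngtP i j) => // ij.
    by case: (mP i j); [rewrite ij -ltnS ltn_ord | exists D, r, s].
  by case: (mP j i); [rewrite ij -ltnS ltn_ord | exists D, s, r].
have /choice[chi chiP] (f : hom A D) : exists i : 'I_n.+1,
    forall (j : 'I_n.+1) (r : hom B D), f = r · m j -> i = j.
  case: (pselect (exists (i : 'I_n.+1) (r : hom B D), f = r · m i)).
    by move=> [i [r fE]]; exists i => j s; rewrite fE => /uniq_index.
  (* Morphisms extending no [m i] get the arbitrary color [ord0]. *)
  by move=> nf; exists ord0 => j r fE; case: nf; exists j, r.
have [w] := ram chi.
(* Every color [c] occurs, since [w · m c] extends [m c]. *)
suff -> : [set c : 'I_n.+1 | `[< exists f : hom A B, chi (w · f) = c >]] = setT.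
  by rewrite cardsT card_ord ltnn.
by apply/setP => c; rewrite !inE; apply/asboolP; exists (m c); apply: chiP.
Qed.

Theorem theorem3p1 (C : category) (dirC : directed C)
  (finC : finite_ramsey_degrees C) : weak_amalgamation C.
Proof.
move=> A; apply: contrapT => noWAP.
have split (A' : Ob C) (f : hom A A') : exists (B1 B2 : Ob C)
    (g : hom A' B1) (h : hom A' B2), ~ compatible (g · f) (h · f).
  apply: contrapT => nosplit; apply: noWAP; exists A', f => B1 B2 g h.
  apply: contrapT => nogh; apply: nosplit; exists B1, B2, g, h.
  by move=> [D [r [s e]]]; apply: nogh; exists D, r, s; rewrite -!compmA.
have := finC A; rewrite /ramsey_degree.
case: pselect => // -[n /asboolP[n_gt0 ramA]] _.
have [B [m mP]] := incompatible_family n dirC split.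
(* One color more than the bound [n] allows. *)
have [D] := ramA n.+1 B isT (inhabits (m 0)).
exact: incompatible_not_ramsey_arrow mP.
Qed.
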